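(* Let $G$ be a finite connected undirected graph (multiple edges and loops allowed), let $<$ be a total order on $E(G)$ and let $A$ be a full orientation of $G$. Let $p$ be a real number with $0<p<1/2$. If each edge of $G$ is, independently, oriented with probability $p$ in each of its two directions and left unoriented with probability $1-2p$, then $R(p)$ is the probability that the resulting random partial orientation is cut minimal with respect to $(<,A)$, where $R$ is the reliability polynomial of $G$.
   Context: Let $n=|V(G)|$ and $g=|E(G)|-|V(G)|+1$. The reliability polynomial of $G$ is $R(p)=(1-p)^{n-1}p^{g}\,T_G(1,1/p)$, where $T_G(x,y)$ is the Tutte polynomial of $G$; $R(p)$ is the probability that the subgraph remaining after removing each edge of $G$ independently with probability $p$ is connected and spans the vertices. A partial orientation of $G$ is an orientation of a subset of the edges; the remaining edges are unoriented (each edge, including each loop, has two possible orientations or is unoriented). A full orientation orients every edge. A directed cut in a partial orientation is the set of all edges between $X$ and $X^c=V(G)\setminus X$, for some $\emptyset\neq X\subsetneq V(G)$, such that every one of these edges is oriented, and all are oriented from $X$ to $X^c$. Given $(<,A)$, a directed cut is minimal if its minimum edge with respect to $<$ is oriented in the same direction as in $A$. A partial orientation is cut minimal if every directed cut in it is minimal. *)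

(* Defs.v *)
From HB Require Import structures.
From mathcomp Require Import all_boot all_order all_algebra.

Set Implicit Arguments.
Unset Strict Implicit.
Unset Printing Implicit Defensive.

Import Order.TTheory GRing.Theory Num.Theory.
Local Open Scope ring_scope.

(* A finite undirected multigraph, loops allowed.  The edge e consists of the
   two half-edges (e, true) and (e, false), and [endpt e b] is the vertex to
   which (e, b) is attached; e is a loop when both are attached to the same
   vertex.  Exchanging the names of the two halves of an edge does not change
   the graph: [endpt] carries no orientation. *)
Record multigraph := Multigraph {
  vert : finType;
  edge : finType;
  endpt : edge -> bool -> vert
}.

Section Graph.
Variable G : multigraph.
Implicit Types (S C : {set edge G}) (X : {set vert G}).

Definition adj S : rel (vert G) := fun u v =>
  [exists e in S, exists b : bool, (endpt e b == u) && (endpt e (~~ b) == v)].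

Definition connected_graph : Prop :=
  (0 < #|vert G|)%N /\ forall u v : vert G, connect (adj setT) u v.

(* Number of connected components of the spanning subgraph (V(G), S). *)
Definition ncomp S : nat := n_comp (adj S) predT.

(* The Tutte polynomial T_G(x, y), as its corank-nullity expansion.  The
   outer variable 'X of {poly {poly K}} is x and 'Y is y, so that
   (tutte K).[a, b] is T_G(a, b).  The truncated subtractions are exact, since
   k(E) <= k(S) and |V| <= k(S) + |S| for every S. *)
Definition tutte (K : comNzRingType) : {poly {poly K}} :=
  \sum_(S : {set edge G})
    ('X - 1) ^+ (ncomp S - ncomp setT) *
    ('Y - 1) ^+ (ncomp S + #|S| - #|vert G|).

(* g = |E| - |V| + 1; for a connected graph the subtraction is exact. *)
Definition nullity : nat := (#|edge G| + 1 - #|vert G|)%N.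

Definition reliability (K : fieldType) (p : K) : K :=
  (1 - p) ^+ (#|vert G| - 1) * p ^+ nullity * (tutte K).[1, 1 / p].

(* Each edge, loop or not, has two orientations: [b : bool] orients e from
   [endpt e b] to [endpt e (~~ b)]. *)
Definition full_orientation := {ffun edge G -> bool}.

(* [None] means that the edge is left unoriented. *)
Definition partial_orientation := {ffun edge G -> option bool}.

Definition cut X : {set edge G} :=
  [set e | (endpt e true \in X) != (endpt e false \in X)].

(* Every edge of the cut of X is oriented, from X to its complement. *)
Definition directed_from (O : partial_orientation) X : bool :=
  [forall e in cut X,
     if O e is Some b then (endpt e b \in X) && (endpt e (~~ b) \notin X)
     else false].

Definition directed_cut (O : partial_orientation) C : bool :=
  [exists X : {set vert G},
     [&& X != set0, X != setT, C == cut X & directed_from O X]].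

Definition min_edge (lt : rel (edge G)) C (e : edge G) : bool :=
  (e \in C) && [forall f in C, (f != e) ==> lt e f].

Definition minimal_cut (lt : rel (edge G)) (A : full_orientation)
    (O : partial_orientation) C : bool :=
  [exists e, min_edge lt C e && (O e == Some (A e))].

Definition cut_minimal (lt : rel (edge G)) (A : full_orientation)
    (O : partial_orientation) : bool :=
  [forall C, directed_cut O C ==> minimal_cut lt A O C].

(* Law of the state of a single edge: probability p for each of the two
   orientations, 1 - 2p for being unoriented. *)
Definition edge_law (K : numFieldType) (p : K) (o : option bool) : K :=
  if o is Some _ then p else 1 - 2 * p.

(* Probability of an event when the edges are independent, each of them
   following [edge_law p]: the product law on partial orientations. *)
Definition orientation_prob (K : numFieldType) (p : K)
    (event : pred partial_orientation) : K :=
  \sum_(O : partial_orientation | event O)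
    \prod_(e : edge G) edge_law p (O e).

End Graph.

Definition strict_total_order (T : eqType) (lt : rel T) : Prop :=
  [/\ irreflexive lt, transitive lt & forall x y, x != y -> lt x y || lt y x].

(* Main.v *)
Require Import Defs.
From mathcomp Require Import all_boot all_order all_algebra.
From mathcomp Require Import ring zify.

Set Implicit Arguments.
Unset Strict Implicit.
Unset Printing Implicit Defensive.

Import Order.TTheory GRing.Theory Num.Theory.
Local Open Scope ring_scope.

(** The reliability polynomial is the probability that the graph left by
    percolation is connected: at x = 1 the corank-nullity expansion of the
    Tutte polynomial keeps the connected spanning subgraphs S, with weight
    (1 - p)^|S| p^|E \ S| ([reliability_expansion]).  It remains to turn the
    random partial orientation into percolation without changing the
    probability of the event.

    Both models live in the space of fourientations, where an edge may be
    traversed in none, one or both of its directions.  A cut of X is open when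
    all its edges may be traversed from X outwards, and a fourientation is
    [good] when every open cut contains a one-way edge and its least one-way
    edge agrees with A.  Edges that are traversable both ways are thus treated
    as deleted, and those that are not traversable as contracted.
    - If no edge is two-way, goodness is cut minimality ([good_of_partial]).
    - If no edge is one-way, an open cut is a violation, and goodness says that
      the contracted edges form a connected spanning subgraph
      ([good_of_subgraph]).

    The edges are switched from the first model to the second one at a time,
    from the largest to the smallest.  When e is switched, all larger edges
    are contracted or deleted.  Fix the state of the edges other than e, and
    let a and b be the truth values of goodness with e oriented in its two
    directions, x its value with e contracted and d its value with e deleted.
    Then a + b = x + d ([good_balance]), so that
      p a + p b + (1 - 2 p) x = (1 - p) x + p d,
    and the switch preserves the probability of goodness ([mixed_prob_step]).

    The delicate half of the identity is that x implies a or b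
    ([good_unoriented_single]).  If both orientations of e were bad, there
    would be open cuts of X and X' crossed by e in opposite directions, each
    with a least one-way edge that disagrees with A.  The smaller of these two
    edges also crosses the cut of the intersection or of the union of X and X';
    those cuts are open and avoid e, and it is still the least one-way edge
    there, against x ([uncrossing]). *)

(** * Orders and sums over finite types *)

Lemma strict_total_order_flip (T : eqType) (lt : rel T) :
  strict_total_order lt -> strict_total_order (fun x y => lt y x).
Proof.
case=> irr tr tot; split=> [x|y x z yx zy|x y xy]; first exact: irr.
  exact: tr zy yx.
by rewrite orbC tot.
Qed.

Lemma exists_least (T : finType) (lt : rel T) (P : pred T) (x : T) :
    strict_total_order lt -> P x ->
  exists2 m, P m & forall y, P y -> y != m -> lt m y.
Proof.
case=> irr tr tot Px.
case: (arg_minnP (fun y => #|[set z | lt z y]|) Px) => m Pm minm.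
exists m => // y Py ym.
case/orP: (tot _ _ ym) => // lt_ym.
suff: (#|[set z | lt z y]| < #|[set z | lt z m]|)%N by rewrite ltnNge minm.
apply/proper_card/properP; split.
  by apply/subsetP=> z; rewrite !inE => /tr; apply.
by exists y; rewrite !inE ?irr.
Qed.

(** Used to restrict a sum over fourientations to the image of one of the two
    models, outside which the weights vanish. *)
Lemma sum_reindex_support (K : nmodType) (I J : finType) (h : J -> I)
    (h' : I -> J) (F : I -> K) :
  cancel h h' -> (forall i, h (h' i) != i -> F i = 0) ->
  \sum_i F i = \sum_j F (h j).
Proof.
move=> hK F0; rewrite (bigID (fun i => h (h' i) == i)) /=.
rewrite [X in _ + X]big1 // addr0 (reindex_onto h h') => [|i /eqP//].
by apply: eq_bigl => j; rewrite hK !eqxx.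
Qed.

Lemma sum_bool2 (K : nmodType) (F : bool * bool -> K) :
  \sum_s F s =
  (F (true, true) + F (true, false)) + (F (false, true) + F (false, false)).
Proof.
rewrite (eq_bigr (fun s => F (s.1, s.2))) => [|[]//].
by rewrite -(pair_bigA _ (fun x y => F (x, y))) /= !big_bool.
Qed.

(** * Cuts and connectivity *)

Section Cuts.
Variable G : multigraph.
Implicit Types (S : {set edge G}) (X : {set vert G}) (e f g : edge G).

Definition leaves X e b := (endpt e b \in X) && (endpt e (~~ b) \notin X).

Lemma cutP X e : reflect (exists b, leaves X e b) (e \in cut X).
Proof.
rewrite inE /leaves; apply: (iffP idP) => [|[b]].
  case te: (_ \in X); case fe: (_ \in X) => // _; last first.
    by exists false; rewrite fe te.
  by exists true; rewrite te fe.
by case: b => /= /andP[-> /negbTE->].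
Qed.

Lemma leaves_cut X e b : leaves X e b -> e \in cut X.
Proof. by move=> l; apply/cutP; exists b. Qed.

Lemma leavesN X e b : leaves X e b -> leaves X e (~~ b) = false.
Proof. by case/andP=> eX _; rewrite /leaves negbK eX andbF. Qed.

Lemma leaves_inj X e b b' : leaves X e b -> leaves X e b' -> b = b'.
Proof.
move=> l; case: (eqVneq b' b) => // /eqP.
by case: b b' l => [] [] // /leavesN /= ->.
Qed.

Lemma leavesC X e b : leaves (~: X) e b = leaves X e (~~ b).
Proof. by rewrite /leaves !inE !negbK andbC. Qed.

Lemma leaves_proper X e b : leaves X e b -> (X != set0) && (X != setT).
Proof.
case/andP=> eX eNX; apply/andP; split; apply/eqP=> EX.
  by rewrite EX inE in eX.
by rewrite EX inE in eNX.
Qed.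

Definition crosses_all_cuts S :=
  [forall X : {set vert G}, (X != set0) && (X != setT) ==>
     [exists e in S, e \in cut X]].

Lemma crosses_all_cutsP S :
  reflect (forall X, X != set0 -> X != setT -> exists2 e, e \in S & e \in cut X)
          (crosses_all_cuts S).
Proof.
apply: (iffP forallP) => cr X.
  by move=> X0 XT; move: (cr X); rewrite X0 XT => /exists_inP.
by apply/implyP=> /andP[X0 XT]; apply/exists_inP/cr.
Qed.

Lemma adj_sym S : symmetric (adj S).
Proof.
suff sub u v : adj S u v -> adj S v u by move=> u v; apply/idP/idP; apply: sub.
case/exists_inP=> e eS /existsP[b /andP[eu ev]].
apply/exists_inP; exists e => //; apply/existsP; exists (~~ b).
by rewrite negbK eu ev.
Qed.

Lemma adj_connect_sym S : connect_sym (adj S).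
Proof. exact/sym_connect_sym/adj_sym. Qed.

Lemma connect_crosses_all_cuts S :
  reflect (forall u v, connect (adj S) u v) (crosses_all_cuts S).
Proof.
apply: (iffP (crosses_all_cutsP S)) => [cr u v|con X]; last first.
  move=> /set0Pn[u uX] XT; apply/exists_inP/contraT=> no.
  have /subsetPn[v _ vX] : ~~ (setT \subset X) by rewrite subTset.
  suff cl : closed (adj S) (mem X).
    by move: vX; rewrite -(closed_connect cl (con u v)) uX.
  apply: (intro_closed (adj_connect_sym S)) => x y.
  case/exists_inP=> e eS /existsP[b /andP[/eqP<- /eqP<-]] xX.
  apply: contraNT no => yX; apply/exists_inP; exists e => //.
  by apply/cutP; exists b; rewrite /leaves xX.
pose X := [set w | connect (adj S) u w].
have uX : u \in X by rewrite inE connect0.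
have [XT|XT] := eqVneq X setT.
  by move: (in_setT v); rewrite -XT inE.
have X0 : X != set0 by apply/set0Pn; exists u.
have [e eS /cutP[b /andP[]]] := cr X X0 XT; rewrite !inE => c1 /negP[].
apply: connect_trans c1 (connect1 _).
by apply/exists_inP; exists e => //; apply/existsP; exists b; rewrite !eqxx.
Qed.

Lemma ncomp_le1 S : (ncomp S <= 1)%N = crosses_all_cuts S.
Proof.
have sym := adj_connect_sym S.
apply/idP/connect_crosses_all_cuts=> [/card_le1_eqP le1 u v|con].
  rewrite -(root_connect sym); apply/eqP/le1; rewrite !inE /= ?andbT;
    exact: roots_root.
apply/card_le1_eqP=> u v; rewrite !inE /= !andbT => /eqP<- /eqP<-.
by apply/eqP; rewrite (root_connect sym).
Qed.

Lemma ncomp_eq1 S :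
  (0 < #|vert G|)%N -> (ncomp S == 1)%N = crosses_all_cuts S.
Proof.
case/card_gt0P=> v _; rewrite eqn_leq ncomp_le1 andbC.
suff -> : (0 < ncomp S)%N by [].
apply/card_gt0P; exists (fingraph.root (adj S) v); rewrite !inE /= ?andbT.
exact/roots_root/adj_connect_sym.
Qed.

(** Growing a vertex set one vertex at a time, each new vertex is reached by
    an edge that did not lie inside the previous set. *)
Lemma crosses_all_cuts_card S :
  (0 < #|vert G|)%N -> crosses_all_cuts S -> (#|vert G| <= #|S|.+1)%N.
Proof.
move=> /card_gt0P[v0 _] /crosses_all_cutsP cr.
pose inner X := [set e in S | (endpt e true \in X) && (endpt e false \in X)].
have grow k : (k < #|vert G|)%N ->
    exists2 X : {set vert G}, #|X| = k.+1 & (k <= #|inner X|)%N.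
  elim: k => [|k IH] kn; first by exists [set v0]; rewrite ?cards1.
  have [X cX iX] := IH (ltnW kn).
  have X0 : X != set0 by rewrite -card_gt0 cX.
  have XT : X != setT by apply: contraTneq kn => XT; rewrite -cX XT cardsT ltnn.
  have [e eS /cutP[b /andP[eX eNX]]] := cr X X0 XT.
  exists (endpt e (~~ b) |: X); first by rewrite cardsU1 eNX cX.
  apply: leq_ltn_trans iX _; apply/proper_card/properP; split.
    apply/subsetP=> f; rewrite !inE => /and3P[-> ->->].
    by rewrite !orbT.
  exists e; rewrite !inE eS /=.
    by case: b eX {eNX} => /= ->; rewrite eqxx !orbT.
  by case: b eX eNX => /= _ /negbTE->; rewrite ?andbF.
have n0 : (0 < #|vert G|)%N by apply/card_gt0P; exists v0.
have [|X _ iX] := grow #|vert G|.-1; first by rewrite prednK.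
rewrite -(prednK n0) ltnS (leq_trans iX) // subset_leq_card //.
by apply/subsetP=> e; rewrite inE => /andP[].
Qed.

End Cuts.

(** * The reliability polynomial as a sum over connected subgraphs *)

Section Reliability.
Variables (K : fieldType) (G : multigraph).

(** At x = 1 the factor (x - 1)^(k(S) - k(E)) kills all but the connected
    subgraphs.  For these the nullity g of the graph is the sum of the nullity
    |S| + 1 - n of S and of |E \ S|, and the prefactor turns
    (1/p - 1)^(|S| + 1 - n) into the percolation weight. *)
Lemma reliability_expansion (p : K) : p != 0 -> connected_graph G ->
  reliability G p =
  \sum_(S : {set edge G} | crosses_all_cuts S)
     (1 - p) ^+ #|S| * p ^+ #|~: S|.
Proof.
move=> p0 [n0 con]; rewrite /reliability /tutte.
have ncT : ncomp (setT : {set edge G}) = 1%N.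
  by apply/eqP; rewrite ncomp_eq1 //; apply/connect_crosses_all_cuts.
rewrite !horner_sum mulr_sumr (bigID (@crosses_all_cuts G)) /=.
rewrite [X in _ + X]big1 ?addr0 => [|S nS]; last first.
  rewrite !hornerE ncT; move: nS; rewrite -ncomp_le1 -ltnNge -subn_gt0.
  by case: (_ - _)%N => // k _; rewrite subrr expr0n /= !(mul0r,mulr0,horner0).
apply: eq_bigr => S cS.
have nS := crosses_all_cuts_card n0 cS.
have /eqP nc1 : ncomp S == 1%N by rewrite ncomp_eq1.
rewrite ncT nc1 subnn expr0 mul1r !hornerE add1n.
have -> : nullity G = (#|S|.+1 - #|vert G| + #|~: S|)%N.
  by rewrite /nullity; have := cardsC S; lia.
have -> : p^-1 - 1 = (1 - p) * p^-1 by field.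
have -> : (1 - p) ^+ #|S| =
    (1 - p) ^+ (#|vert G| - 1) * (1 - p) ^+ (#|S|.+1 - #|vert G|).
  by rewrite -exprD; congr (_ ^+ _); lia.
rewrite exprD exprMn exprVn.
have := expf_neq0 (#|S|.+1 - #|vert G|)%N p0.
by move: (p ^+ (_ - _)%N) => q q0; field.
Qed.

End Reliability.

(** * Fourientations and the local identity *)

Section Fourientations.
Variable G : multigraph.

(** The two booleans tell whether the edge may be traversed from its [true]
    half-edge and from its [false] half-edge, so that [(true, true)] stands for
    a deleted edge and [(false, false)] for an unoriented or contracted one. *)
Definition fourientation := {ffun edge G -> bool * bool}.
Implicit Types (c : fourientation) (X : {set vert G}) (e f g : edge G).

Definition allows (s : bool * bool) (b : bool) := if b then s.1 else s.2.
Definition oneway (s : bool * bool) := s.1 != s.2.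
Definition single (b : bool) := (b, ~~ b).

Lemma allows_single b b' : allows (single b) b' = (b == b').
Proof. by case: b; case: b'. Qed.

Lemma oneway_single b : oneway (single b).
Proof. by case: b. Qed.

Lemma oneway_allowsN s b : oneway s -> allows s b -> allows s (~~ b) = false.
Proof. by case: s b => [[] []] []. Qed.

Definition upd c e s : fourientation := [ffun f => if f == e then s else c f].

Lemma upd_same c e s : upd c e s e = s.
Proof. by rewrite ffunE eqxx. Qed.

Lemma upd_other c e s f : f != e -> upd c e s f = c f.
Proof. by rewrite ffunE => /negbTE->. Qed.

Lemma upd_upd c e s s' : upd (upd c e s) e s' = upd c e s'.
Proof. by apply/ffunP=> f; rewrite !ffunE; case: eqP. Qed.

Lemma upd_id c e : upd c e (c e) = c.
Proof. by apply/ffunP=> f; rewrite ffunE; case: eqP => [->|]. Qed.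

Definition open_cut c X :=
  [forall e, forall b, leaves X e b ==> allows (c e) b].

Definition oneway_cut c X := [set e in cut X | oneway (c e)].

Variables (lt : rel (edge G)) (A : full_orientation G).
Hypothesis hlt : strict_total_order lt.

Definition good_cut c X := [exists e,
  min_edge lt (oneway_cut c X) e && allows (c e) (A e)].

(** Cut minimality, with the two-way edges ignored when the least edge of a cut
    is looked up.  An open cut without one-way edges is not good. *)
Definition good c :=
  [forall X, [&& X != set0, X != setT & open_cut c X] ==> good_cut c X].

Lemma in_oneway_cut c X f :
  (f \in oneway_cut c X) = (f \in cut X) && oneway (c f).
Proof. by rewrite inE. Qed.

Lemma open_cutP c X :
  reflect (forall e b, leaves X e b -> allows (c e) b) (open_cut c X).
Proof.
apply: (iffP forallP) => [o e b|o e].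
  by move: (o e) => /forallP/(_ b)/implyP.
by apply/forallP=> b; apply/implyP/o.
Qed.

Lemma goodP c :
  reflect (forall X, X != set0 -> X != setT -> open_cut c X -> good_cut c X)
          (good c).
Proof.
apply: (iffP forallP) => gd X.
  by move=> X0 XT oX; move: (gd X); rewrite X0 XT oX.
by apply/implyP=> /and3P[]; apply: gd.
Qed.

Lemma min_edgeP (C : {set edge G}) e :
  reflect (e \in C /\ forall f, f \in C -> f != e -> lt e f) (min_edge lt C e).
Proof.
apply: (iffP andP) => -[eC mn]; split=> //.
  by move=> f fC; move/forall_inP: mn => /(_ f fC)/implyP.
by apply/forall_inP=> f fC; apply/implyP/mn.
Qed.

Lemma exists_min_edge (C : {set edge G}) e :
  e \in C -> exists f, min_edge lt C f.
Proof.
by move=> eC; have [f fC mf] := exists_least hlt eC; exists f; apply/min_edgeP.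
Qed.

Variables (c : fourientation) (e : edge G).
Hypothesis late : forall f, lt e f -> ~~ oneway (c f).

Let with_e s := upd c e s.

Lemma oneway_cut_upd s X f : f != e ->
  (f \in oneway_cut (with_e s) X) = (f \in cut X) && oneway (c f).
Proof. by move=> fe; rewrite inE upd_other. Qed.

Lemma good_cut_upd s s' X : e \notin cut X ->
  good_cut (with_e s) X = good_cut (with_e s') X.
Proof.
move=> eX; rewrite /good_cut.
have -> : oneway_cut (with_e s) X = oneway_cut (with_e s') X.
  apply/setP=> f; rewrite !inE -/(f \in cut X).
  have [->|fe] := eqVneq f e; last by rewrite !upd_other.
  by move: eX; rewrite inE => /negbTE->.
apply: eq_existsb => f; have [->|fe] := eqVneq f e; last by rewrite !upd_other.
suff -> : min_edge lt (oneway_cut (with_e s') X) e = false by [].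
by rewrite /min_edge inE (negbTE eX).
Qed.

Lemma open_cut_upd s s' X :
  (forall b, leaves X e b -> allows s b -> allows s' b) ->
  open_cut (with_e s) X -> open_cut (with_e s') X.
Proof.
move=> ss' /open_cutP oX; apply/open_cutP=> f b lf; have := oX _ _ lf.
have [?|fe] := eqVneq f e; last by rewrite !upd_other.
by subst f; rewrite !upd_same; apply: ss'.
Qed.

(** Making [e] one-way does not displace the least one-way edge of a cut: that
    edge is one-way, so it is not larger than [e]. *)
Lemma min_edge_bioriented_single X f b :
    min_edge lt (oneway_cut (with_e (true, true)) X) f ->
  min_edge lt (oneway_cut (with_e (single b)) X) f.
Proof.
case/min_edgeP=> fX mf.
have fe : f != e by apply: contraTneq fX => ->; rewrite inE upd_same andbF.
move: fX; rewrite oneway_cut_upd // => /andP[fX ow].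
apply/min_edgeP; split=> [|g]; first by rewrite oneway_cut_upd ?fX.
have [-> _ _|ge gX gf] := eqVneq g e.
  case: hlt => _ _ /(_ _ _ fe)/orP[//|ef].
  by move: (late ef); rewrite ow.
by apply: mf gf; move: gX; rewrite !oneway_cut_upd.
Qed.

Lemma good_bioriented_single b :
  good (with_e (true, true)) -> good (with_e (single b)).
Proof.
move/goodP=> gd; apply/goodP=> X X0 XT oX.
have oX' : open_cut (with_e (true, true)) X by apply: open_cut_upd oX => -[].
have /existsP[f /andP[mf af]] := gd X X0 XT oX'.
apply/existsP; exists f; rewrite min_edge_bioriented_single //=.
have fe : f != e.
  by apply: contraTneq mf => ->; rewrite /min_edge inE upd_same andbF.
by move: af; rewrite !upd_other.
Qed.

(** An unoriented edge closes the cuts that it crosses, and the cuts that it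
    does not cross do not see its state. *)
Lemma good_single_unoriented b :
  good (with_e (single b)) -> good (with_e (false, false)).
Proof.
move/goodP=> gd; apply/goodP=> X X0 XT oX.
have eX : e \notin cut X.
  apply/cutP=> -[b' le]; move/open_cutP: oX => /(_ _ _ le).
  by rewrite upd_same; case: (b').
rewrite (good_cut_upd _ (single b)) //; apply: gd => //.
by apply: open_cut_upd oX => b'; case: b'.
Qed.

(** A cut of [X] crossed by the deleted edge [e] is open for the orientation of
    [e] out of [X], hence has a good least one-way edge.  This edge could only
    fail to be good for the deleted [e] by being [e] itself; then [e] agrees
    with [A] and is the only one-way edge of the cut, so the complement of [X]
    is open once [e] is reversed, and its least one-way edge, again [e], has to
    agree with [A] in the reverse direction as well. *)
Lemma good_singles_bioriented :
  (forall b, good (with_e (single b))) -> good (with_e (true, true)).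
Proof.
move=> gd; apply/goodP=> X X0 XT oX.
have [/cutP[b le]|eX] := boolP (e \in cut X); last first.
  rewrite (good_cut_upd _ (single true)) //; apply: (goodP _ (gd true)) => //.
  by apply: open_cut_upd oX => b' /leaves_cut; rewrite (negbTE eX).
have oXb : open_cut (with_e (single b)) X.
  apply: open_cut_upd oX => b' le' _; rewrite allows_single.
  by rewrite (leaves_inj le le').
have /existsP[f /andP[mf af]] := goodP _ (gd b) X X0 XT oXb.
have [fX mfX] := min_edgeP _ _ mf.
have [fe|fe] := eqVneq f e.
  subst f; move: af; rewrite upd_same allows_single => /eqP bA.
  (* a one-way edge larger than the least one, [e], would contradict [late] *)
  have only g : g \in cut X -> g != e -> ~~ oneway (c g).
    move=> gX ge; apply/negP=> ow; have := mfX g.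
    by rewrite oneway_cut_upd // gX ow => /(_ isT ge)/late; rewrite ow.
  have oXC : open_cut (with_e (single (~~ b))) (~: X).
    apply/open_cutP=> g b'; rewrite leavesC => lg.
    have [ge|ge] := eqVneq g e.
      subst g; rewrite upd_same allows_single.
      by rewrite (leaves_inj le lg) negbK.
    have := open_cutP _ _ oX _ _ lg; rewrite !upd_other //.
    have := only g (leaves_cut lg) ge; rewrite negbK => /eqP.
    by case: (c g) b' {lg} => [x y] [] /= ->.
  have [X0' XT'] : ~: X != set0 /\ ~: X != setT.
    apply/andP; apply: (@leaves_proper _ _ e (~~ b)).
    by rewrite leavesC negbK.
  have /existsP[f /andP[/min_edgeP[fXC _] af]] :=
    goodP _ (gd (~~ b)) _ X0' XT' oXC.
  have fX' : f \in cut X.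
    move: fXC; rewrite in_oneway_cut => /andP[/cutP[b']].
    by rewrite leavesC => /leaves_cut.
  have [fe|fe] := eqVneq f e.
    by subst f; move: af; rewrite upd_same allows_single -bA; case: (b).
  by move: fXC; rewrite oneway_cut_upd // (negbTE (only _ fX' fe)) andbF.
apply/existsP; exists f; apply/andP.
split; last by move: af; rewrite !upd_other.
apply/min_edgeP; split; first by move: fX; rewrite !oneway_cut_upd.
move=> g; have [->|ge] := eqVneq g e; first by rewrite inE upd_same andbF.
by rewrite oneway_cut_upd // => gX gf; apply: mfX; rewrite ?oneway_cut_upd.
Qed.

(** A witness against goodness for [e] oriented by [b] is a cut crossed by [e],
    since the other cuts are the same as for the unoriented [e]; so it does have
    a least one-way edge, which disagrees with [A]. *)
Lemma bad_single b :
    good (with_e (false, false)) -> ~~ good (with_e (single b)) ->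
  exists X f, [/\ open_cut (with_e (single b)) X, leaves X e b,
    min_edge lt (oneway_cut (with_e (single b)) X) f
    & ~~ allows (with_e (single b) f) (A f)].
Proof.
move=> gd; rewrite negb_forall => /existsP[X].
rewrite negb_imply => /andP[/and3P[X0 XT oX] bad].
have [/cutP[b' le]|eX] := boolP (e \in cut X); last first.
  case/negP: bad; rewrite (good_cut_upd _ (false, false)) //.
  apply: (goodP _ gd) => //; apply: open_cut_upd oX => b' /leaves_cut.
  by rewrite (negbTE eX).
have /eqP bb : b == b'.
  by have := open_cutP _ _ oX _ _ le; rewrite upd_same allows_single.
subst b'.
have [|f mf] := @exists_min_edge (oneway_cut (with_e (single b)) X) e.
  by rewrite inE (leaves_cut le) upd_same oneway_single.
exists X, f; split=> //.
by move: bad; rewrite negb_exists => /forallP/(_ f); rewrite mf.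
Qed.

(** A one-way edge cannot join X \ X' to X' \ X: being traversable outwards for
    both open cuts, it would be two-way.  Hence [f], which crosses the cut of
    [X], crosses the cut of the intersection or of the union as well.  The edge
    [e] does join the two differences, so it crosses neither; both cuts are
    therefore open with [e] unoriented.  Their one-way edges belong to the cuts
    of [X] and [X'], of which [f] is the least one, so [f] is the edge whose
    direction goodness controls. *)
Lemma uncrossing b X X' f :
    good (with_e (false, false)) ->
    open_cut (with_e (single b)) X -> open_cut (with_e (single (~~ b))) X' ->
    leaves X e b -> leaves X' e (~~ b) ->
    f != e -> f \in oneway_cut c X ->
    (forall g, g \in oneway_cut c X -> g != f -> g != e -> lt f g) ->
    (forall g, g \in oneway_cut c X' -> g != f -> g != e -> lt f g) ->
  allows (c f) (A f).
Proof.
move=> gd oX oX' le le' fe; rewrite inE => /andP[/cutP[d lf] ow] mf mf'.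
have af : allows (c f) d.
  by have := open_cutP _ _ oX _ _ lf; rewrite upd_other.
(* an edge leaving the intersection or the union leaves [X] or [X'] in the
   same direction *)
have split_leaves Y g d' : Y = X :&: X' \/ Y = X :|: X' ->
    leaves Y g d' -> g != e /\ (leaves X g d' || leaves X' g d').
  move=> YE lY; split.
    apply: contraTneq lY => ->; move: le le'; rewrite /leaves negbK.
    by case: YE => ->; rewrite !inE; case: b {oX oX'} => /=; case: d' => /=;
      do 4! case: (_ \in _).
  move: lY; rewrite /leaves.
  by case: YE => ->; rewrite !inE; do 4! case: (_ \in _).
have [Y YE lY] : exists2 Y, Y = X :&: X' \/ Y = X :|: X' & leaves Y f d.
  have nd : leaves X' f (~~ d) = false.
    apply/negP=> lf'; have := open_cutP _ _ oX' _ _ lf'.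
    by rewrite upd_other // oneway_allowsN.
  move: lf nd; rewrite /leaves negbK => /andP[fX fNX].
  have [fX'|fX'] := boolP (endpt f d \in X').
    by move=> _; exists (X :&: X'); [left | rewrite !inE fX fX' (negbTE fNX)].
  rewrite andbT => nd; exists (X :|: X'); first by right.
  by rewrite !inE fX (negbTE fNX) nd.
have /andP[Y0 YT] := leaves_proper lY.
have oY : open_cut (with_e (false, false)) Y.
  apply/open_cutP=> g d' lg; have [ge] := split_leaves Y g d' YE lg.
  case/orP=> l.
    by have := open_cutP _ _ oX _ _ l; rewrite !upd_other.
  by have := open_cutP _ _ oX' _ _ l; rewrite !upd_other.
have /existsP[g /andP[/min_edgeP[gY mg] ag]] := goodP _ gd Y Y0 YT oY.
have ge : g != e by apply: contraTneq gY => ->; rewrite inE upd_same andbF.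
rewrite upd_other // in ag.
move: gY; rewrite oneway_cut_upd // => /andP[/cutP[d' lg] owg].
have [_ lXg] := split_leaves Y g d' YE lg.
have [<- //|gf] := eqVneq g f.
have fg : lt f g.
  by case/orP: lXg => /leaves_cut lXg; [apply: mf|apply: mf'];
    rewrite // inE lXg owg.
have gf' : lt g f.
  by apply: mg; rewrite 1?eq_sym // oneway_cut_upd // ow (leaves_cut lY).
by case: hlt => irr tr _; have := tr _ _ _ fg gf'; rewrite irr.
Qed.

Lemma good_unoriented_single :
  good (with_e (false, false)) -> exists b, good (with_e (single b)).
Proof.
move=> gd.
(* by symmetry, the least one-way edge for [b] comes no later than the one
   for [~~ b] *)
suff main b X X' f f' :
    open_cut (with_e (single b)) X -> open_cut (with_e (single (~~ b))) X' ->
    leaves X e b -> leaves X' e (~~ b) ->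
    min_edge lt (oneway_cut (with_e (single b)) X) f ->
    min_edge lt (oneway_cut (with_e (single (~~ b))) X') f' ->
    ~~ allows (with_e (single b) f) (A f) ->
    ~~ allows (with_e (single (~~ b)) f') (A f') -> (f == f') || lt f f' ->
    False.
  have [gt|/(bad_single gd)[Xt [ft [ot lt_ mt at_]]]] :=
    boolP (good (with_e (single true))); first by exists true.
  have [gf|/(bad_single gd)[Xf [ff [of_ lf mf af]]]] :=
    boolP (good (with_e (single false))); first by exists false.
  exfalso.
  have [ff'|ff'] := boolP ((ft == ff) || lt ft ff).
    exact: main ot of_ lt_ lf mt mf at_ af ff'.
  apply: (main _ _ _ _ _ of_ ot lf lt_ mf mt af at_).
  move: ff'; rewrite negb_or eq_sym => /andP[ff' nlt].
  have [_ _ tot] := hlt.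
  by have := tot _ _ ff'; rewrite (negbTE nlt) orbF => ->; rewrite orbT.
move=> oX oX' le le' /min_edgeP[fX mf] /min_edgeP[fX' mf'] af af' ff'.
(* otherwise, as no one-way edge is larger than [e], both least edges are [e],
   which agrees with [A] in one of its two orientations *)
have fe : f != e.
  apply/eqP=> fe; subst f; move: af; rewrite upd_same allows_single.
  have [f'e|f'e] := eqVneq f' e.
    subst f'; move: af'; rewrite upd_same allows_single.
    by case: (b); case: (A e).
  rewrite eq_sym (negbTE f'e) in ff'.
  by move: fX'; rewrite oneway_cut_upd // (negbTE (late ff')) andbF.
case/negP: af; rewrite upd_other //.
apply: (uncrossing gd oX oX' le le' fe).
- by move: fX; rewrite oneway_cut_upd // -in_oneway_cut.
- move=> g gX gf ge; apply: mf => //.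
  by rewrite oneway_cut_upd // -in_oneway_cut.
move=> g gX gf ge; have gX' : g \in oneway_cut (with_e (single (~~ b))) X'.
  by rewrite oneway_cut_upd // -in_oneway_cut.
case/predU1P: ff' => [->|ff'] in gf mf' *; first exact: mf'.
have [->//|gf'] := eqVneq g f'.
by case: hlt => _ tr _; apply: tr ff' _; apply: mf'.
Qed.

(** Goodness with [e] unoriented is the disjunction, and goodness with [e]
    deleted the conjunction, of goodness for the two orientations of [e]. *)
Lemma good_balance :
  (good (with_e (true, false)) + good (with_e (false, true)) =
   good (with_e (false, false)) + good (with_e (true, true)))%N.
Proof.
have dt := @good_bioriented_single true.
have df := @good_bioriented_single false.
have tc := @good_single_unoriented true.
have fc := @good_single_unoriented false.
have tfd := good_singles_bioriented; have ctf := good_unoriented_single.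
rewrite -[(true, false)]/(single true) -[(false, true)]/(single false).
have [t|t] := boolP (good (with_e (single true)));
  have [f|f] := boolP (good (with_e (single false))).
- by rewrite tc // tfd // => -[].
- by rewrite tc //; case: (good _) df f => // ->.
- by rewrite fc //; case: (good _) dt t => // ->.
case: (good (with_e (true, true))) dt t => [->//|_ t].
by case: (good _) ctf t f => // -[] // [] ->.
Qed.

End Fourientations.

(** * From random orientations to percolation *)

Section MixedLaw.
Variables (K : numFieldType) (G : multigraph).
Variables (lt : rel (edge G)) (A : full_orientation G) (p : K).
Hypothesis hlt : strict_total_order lt.
Implicit Types (D : {set edge G}) (c : fourientation G).

Definition oriented_law (s : bool * bool) : K :=
  if oneway s then p else if s.1 then 0 else 1 - 2 * p.

Definition percolation_law (s : bool * bool) : K :=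
  if oneway s then 0 else if s.1 then p else 1 - p.

(** The edges of [D] have been switched to percolation. *)
Definition mixed_law D e := if e \in D then percolation_law else oriented_law.

Definition mixed_prob D : K :=
  \sum_(c : fourientation G) (\prod_e mixed_law D e (c e)) * (good lt A c)%:R.

(** Summing over the state of [e] first; the fourientations whose value at [e]
    is the dummy [s0] represent the states of the other edges. *)
Lemma sum_upd (e : edge G) s0 (F : fourientation G -> K) :
  \sum_c F c = \sum_(c : fourientation G | c e == s0) \sum_s F (upd c e s).
Proof.
rewrite (partition_big (fun c => upd c e s0)
          (fun c : fourientation G => c e == s0)) /=; last first.
  by move=> c _; rewrite upd_same.
apply: eq_bigr => c /eqP ces0.
rewrite (reindex_onto (fun s => upd c e s)
           (fun c' : fourientation G => c' e)) /=; last first.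
  by move=> c' /eqP<-; rewrite upd_upd upd_id.
by apply: eq_bigl => s; rewrite upd_upd upd_same -ces0 upd_id !eqxx.
Qed.

Lemma mixed_prod_upd D e c s :
  \prod_f mixed_law D f (upd c e s f) =
  mixed_law D e s * \prod_(f | f != e) mixed_law D f (c f).
Proof.
rewrite (bigD1 e) //= upd_same; congr (_ * _).
by apply: eq_bigr => f fe; rewrite upd_other.
Qed.

(** Conditionally on the other edges, this is [good_balance] multiplied by [p].
    Its hypothesis on the larger edges, which are all in [D], holds unless
    their weight is zero. *)
Lemma mixed_prob_step D e :
    e \notin D -> (forall f, lt e f -> f \in D) ->
  mixed_prob D = mixed_prob (e |: D).
Proof.
move=> eD up; rewrite /mixed_prob 2!(sum_upd e (false, false)).
apply: eq_bigr => c _.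
have E D' : \sum_s (\prod_f mixed_law D' f (upd c e s f)) *
      (good lt A (upd c e s))%:R =
    \sum_s (mixed_law D' e s * (good lt A (upd c e s))%:R) *
      \prod_(f | f != e) mixed_law D' f (c f).
  by apply: eq_bigr => s _; rewrite mixed_prod_upd mulrAC.
rewrite !E -!mulr_suml.
have -> : \prod_(f | f != e) mixed_law (e |: D) f (c f) =
          \prod_(f | f != e) mixed_law D f (c f).
  by apply: eq_bigr => f fe; rewrite /mixed_law !inE (negbTE fe).
have [->|/prodf_neq0 P0] :=
  eqVneq (\prod_(f | f != e) mixed_law D f (c f)) 0; first by rewrite !mulr0.
have late f : lt e f -> ~~ oneway (c f).
  move=> ef; have fe : f != e.
    by apply: contraTneq ef => ->; case: hlt => ->.
  have := P0 f fe; rewrite /mixed_law up // /percolation_law.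
  by case: ifP => //; rewrite eqxx.
have bal := congr1 (fun n => n%:R : K) (good_balance A hlt late).
rewrite !natrD in bal.
congr (_ * _); rewrite /mixed_law setU11 (negbTE eD).
rewrite !sum_bool2 /oriented_law /percolation_law /=.
move: bal; do 4! move: ((good _ _ _)%:R); move=> a b x d bal.
transitivity (p * (d + x) + (1 - 2 * p) * b); first by ring.
by rewrite bal; ring.
Qed.

(** Induction on the number of edges outside [D], switching the largest one. *)
Lemma mixed_prob_upclosed D :
  (forall e f, e \in D -> lt e f -> f \in D) -> mixed_prob D = mixed_prob setT.
Proof.
have [n] := ubnP #|~: D|; elim: n D => // n IH D Dn up.
have [DT|[e eD]] := set_0Vmem (~: D); first by rewrite -[D]setCK DT setC0.
rewrite inE in eD.
have [m mD mmax] :=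
  exists_least (P := [predC D]) (strict_total_order_flip hlt) eD.
have lt_irr : irreflexive lt by case: hlt.
have lt_tr : transitive lt by case: hlt.
have later f : lt m f -> f \in D.
  move=> mf; apply: contraTT mf => fD.
  have [->|fm] := eqVneq f m; first by rewrite lt_irr.
  have fm' : lt f m by apply: mmax; rewrite //= fD.
  by apply/negP=> mf; move: (lt_tr _ _ _ mf fm'); rewrite lt_irr.
rewrite (mixed_prob_step mD later); apply: IH => [|e' f].
  rewrite -ltnS; apply: leq_trans Dn; rewrite ltnS.
  apply/proper_card/properP; split; first by rewrite setCS subsetUr.
  by exists m; rewrite ?inE // eqxx.
by rewrite !inE => /predU1P[->/later->|/up ud /ud->]; rewrite orbT.
Qed.

Definition of_partial_orientation (O : partial_orientation G) :
    fourientation G :=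
  [ffun e => if O e is Some b then single b else (false, false)].

Lemma allows_of_partial O e b :
  allows (of_partial_orientation O e) b = (O e == Some b).
Proof. by rewrite ffunE; case: (O e) => [[]|]; case: b. Qed.

Lemma open_of_partial O X :
  open_cut (of_partial_orientation O) X = directed_from O X.
Proof.
apply/open_cutP/forall_inP => [o e /cutP[b l]|d e b l].
  by have := o e b l; rewrite allows_of_partial => /eqP->.
have := d e (leaves_cut l); rewrite allows_of_partial.
by case: (O e) => // b' l'; rewrite (leaves_inj l l').
Qed.

Lemma good_of_partial O :
  good lt A (of_partial_orientation O) = cut_minimal lt A O.
Proof.
have gE X : directed_from O X ->
    good_cut lt A (of_partial_orientation O) X = minimal_cut lt A O (cut X).
  move=> dX; rewrite /good_cut /minimal_cut.
  have -> : oneway_cut (of_partial_orientation O) X = cut X.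
    apply/setP=> e; rewrite in_oneway_cut.
    have [eX|//] := boolP (e \in cut X).
    move/forall_inP: dX => /(_ e eX); rewrite ffunE.
    by case: (O e) => // b _; rewrite oneway_single.
  by apply: eq_existsb => e; rewrite allows_of_partial.
apply/goodP/forallP => [gd C|cm X X0 XT].
  apply/implyP=> /existsP[X /and4P[X0 XT /eqP-> dX]].
  by rewrite -gE //; apply: gd => //; rewrite open_of_partial.
rewrite open_of_partial => dX; rewrite gE //.
apply: (implyP (cm (cut X))); apply/existsP; exists X.
by rewrite X0 XT eqxx dX.
Qed.

Lemma mixed_prob_set0 : mixed_prob set0 = orientation_prob p (cut_minimal lt A).
Proof.
pose h' c : partial_orientation G :=
  [ffun e => if oneway (c e) then Some (c e).1 else None].
rewrite /mixed_prob.
rewrite (sum_reindex_support (h := of_partial_orientation) (h' := h')).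
- rewrite /orientation_prob [RHS]big_mkcond /=; apply: eq_bigr => O _.
  rewrite good_of_partial mulr_natr mulrb; case: ifP => // _.
  apply: eq_bigr => e _; rewrite /mixed_law inE ffunE.
  by case: (O e) => [[]|].
- by move=> O; apply/ffunP=> e; rewrite !ffunE; case: (O e) => [[]|].
move=> c; apply: contraNeq; rewrite mulf_eq0 negb_or => /andP[/prodf_neq0 c0 _].
apply/eqP/ffunP=> e; rewrite !ffunE.
have := c0 e isT; rewrite /mixed_law inE /oriented_law.
by case: (c e) => [[] []] //=; rewrite eqxx.
Qed.

Definition of_subgraph (S : {set edge G}) : fourientation G :=
  [ffun e => if e \in S then (false, false) else (true, true)].

(** No edge is one-way here, so goodness means that there is no open cut. *)
Lemma good_of_subgraph S : good lt A (of_subgraph S) = crosses_all_cuts S.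
Proof.
apply/goodP/crosses_all_cutsP => cr X X0 XT; last first.
  have [e eS /cutP[b l]] := cr X X0 XT.
  by move/open_cutP/(_ e b l); rewrite ffunE eS; case: b {l}.
apply/exists_inP/contraT=> no.
suff /cr : open_cut (of_subgraph S) X.
  case/(_ X0 XT)/existsP=> e /andP[/min_edgeP[]].
  by rewrite in_oneway_cut ffunE; case: ifP; rewrite andbF.
apply/open_cutP=> e b l; rewrite ffunE.
case: ifP => [eS|_]; last by case: b {l}.
by case/negP: no; apply/exists_inP; exists e => //; apply: leaves_cut l.
Qed.

Lemma mixed_prob_setT :
  mixed_prob setT =
  \sum_(S : {set edge G} | crosses_all_cuts S)
     (1 - p) ^+ #|S| * p ^+ #|~: S|.
Proof.
pose h' c := [set e | c e == (false, false)].
rewrite /mixed_prob (sum_reindex_support (h := of_subgraph) (h' := h')).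
- rewrite [RHS]big_mkcond /=; apply: eq_bigr => S _.
  rewrite good_of_subgraph mulr_natr mulrb; case: ifP => // _.
  rewrite (bigID (mem S)) /= -!prodr_const; congr (_ * _).
    by apply: eq_bigr => e eS; rewrite /mixed_law inE ffunE eS.
  apply: eq_big => [e|e eS]; first by rewrite inE.
  by rewrite /mixed_law inE ffunE (negbTE eS).
- by move=> S; apply/setP=> e; rewrite inE ffunE; case: (e \in S).
move=> c; apply: contraNeq; rewrite mulf_eq0 negb_or => /andP[/prodf_neq0 c0 _].
apply/eqP/ffunP=> e; rewrite ffunE inE.
have := c0 e isT; rewrite /mixed_law inE /percolation_law.
by case: (c e) => [[] []] //=; rewrite eqxx.
Qed.

End MixedLaw.

Theorem corollary5p2 (R : realFieldType) (G : multigraph)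
    (lt : rel (edge G)) (A : full_orientation G) (p : R)
    (hG : connected_graph G) (hlt : strict_total_order lt)
    (hp0 : 0 < p) (hp1 : p < 1 / 2) :
  reliability G p = orientation_prob p (cut_minimal lt A).
Proof.
have p0 : p != 0 by rewrite gt_eqF.
rewrite (reliability_expansion p0 hG) -(mixed_prob_set0 lt A).
rewrite (mixed_prob_upclosed A p hlt) ?mixed_prob_setT // => e f.
by rewrite inE.
Qed.
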